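(* Let $\mathbb{F}_q$ have prime characteristic $p$. Then: (i) $P(1,\mathbb{F}_q)=D(q-1)$. (ii) $P(2,\mathbb{F}_q)=D(q^2-1)\cup pD(q-1)$. (iii) $P(3,\mathbb{F}_q)=D(q^3-1)\cup D(q^2-1)\cup pD(q-1)$ if $p\ge3$, and $P(3,\mathbb{F}_q)=D(q^3-1)\cup D(q^2-1)\cup \{2,4\}D(q-1)$ if $p=2$. (iv) $P(4,\mathbb{F}_q)=D(q^4-1)\cup D(q^3-1)\cup pD(q^2-1)$ if $p\ge5$, and $P(4,\mathbb{F}_q)=D(q^4-1)\cup D(q^3-1)\cup pD(q^2-1)\cup p^2D(q-1)$ if $p\in\{2,3\}$. Equivalently, for $1\le k\le 4$ one has $P(k,\mathbb{F}_q)=\bigcup_{i=1}^k \{p^j : 0\le j\le t_i\}\,D(q^i-1)$ with $t_i=\min\{t\in\mathbb{Z}: p^t\ge\lfloor k/i\rfloor\}$.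
   Context: A sequence $(a_n)_{n\ge0}$ over $\mathbb{F}_q$ satisfies a linear recurrence of degree $k$ if there are $c_0,\dots,c_{k-1}\in\mathbb{F}_q$, with $c_0\neq0$ (standing assumption), such that $a_{n+k}=\sum_{i=0}^{k-1}c_ia_{n+i}$ for all $n\ge0$; such sequences are purely periodic and $\rho(\mathbf{a})$ is the least $m>0$ with $a_{n+m}=a_n$ for all $n\ge0$. $P(k,\mathbb{F}_q)$ is the set of all $\rho(\mathbf{a})$ for sequences $\mathbf{a}$ satisfying some linear recurrence of degree $k$ over $\mathbb{F}_q$. For $n\in\mathbb{Z}_{>0}$, $D(n)$ is the set of positive divisors of $n$. For sets $S_1,S_2\subseteq\mathbb{Z}$ and $a\in\mathbb{Z}$, $aS_1=\{ax: x\in S_1\}$ and $S_1S_2=\{xy : x\in S_1, y\in S_2\}$. *)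

(* Defs.v *)
From HB Require Import structures.
From mathcomp Require Import all_boot all_order all_algebra all_field.
Set Implicit Arguments. Unset Strict Implicit. Unset Printing Implicit Defensive.
Import GRing.Theory.
Local Open Scope ring_scope.

Definition satisfies_lrec (F : fieldType) (k : nat) (a : nat -> F) : Prop :=
  exists c : nat -> F, c 0%N != 0 /\
    forall n : nat, a (n + k)%N = \sum_(i < k) c i * a (n + i)%N.

Definition least_period (F : Type) (a : nat -> F) (m : nat) : Prop :=
  (0 < m)%N /\ (forall n, a (n + m)%N = a n) /\
  (forall m', (0 < m')%N -> (forall n, a (n + m')%N = a n) -> (m <= m')%N).

Definition Pset (F : fieldType) (k : nat) (m : nat) : Prop :=
  exists a : nat -> F, satisfies_lrec k a /\ least_period a m.

Definition D (n : nat) (d : nat) : Prop := (0 < d)%N /\ (d %| n)%N.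

Definition smul (a : nat) (S : nat -> Prop) (m : nat) : Prop :=
  exists x, S x /\ m = (a * x)%N.

Definition setmul (S1 S2 : nat -> Prop) (m : nat) : Prop :=
  exists x y, S1 x /\ S2 y /\ m = (x * y)%N.

(* Main.v *)
Require Import Defs.
From HB Require Import structures.
From mathcomp Require Import all_boot all_order all_algebra all_field.
From mathcomp Require Import cyclic zify.
Import GRing.Theory.
Set Implicit Arguments. Unset Strict Implicit. Unset Printing Implicit Defensive.
Local Open Scope ring_scope.

(** Periods of linear recurring sequences are the orders of ['X] modulo their
    characteristic polynomials.

    If [f] annihilates a sequence under the shift and [f %| 'X^n - 1], then [n]
    is a period.  An irreducible [f] of degree [d] with [f`_0 != 0] divides
    ['X^(q ^ d - 1) - 1], and ['X^(p ^ t * n) - 1 = ('X^n - 1) ^+ (p ^ t)], so the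
    factorisation type of a polynomial of degree at most 4 bounds the period.

    Conversely, the coefficients of ['X^(deg f - 1)] in the powers ['X^n %% f]
    form a sequence whose least period is exactly the order of ['X] modulo [f].
    Taking for [f] the [j]-th power of the minimal polynomial of an element of
    order [m] in an extension of degree [d], that order is [p ^ t * m] with [t]
    minimal such that [j <= p ^ t]. *)

(** * Characteristic polynomials of sequences *)

Section Polynomials.
Variable F : fieldType.
Implicit Types (f g h u : {poly F}) (a : nat -> F).

Lemma dvdp_Xn_sub_1_trans h m n : (m %| n)%N -> h %| 'X^m - 1 -> h %| 'X^n - 1.
Proof.
case/dvdnP=> k ->; rewrite mulnC exprM => /dvdp_trans; apply.
by rewrite -[X in _ %| _ - X](expr1n _ k) subrXX dvdp_mulr.
Qed.

(** Frobenius additivity. This turns multiplicities of factors into powers of [p] in the period. *)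
Lemma Xn_sub_1_pexp p t n : p \in [pchar F] ->
  'X^(p ^ t * n) - 1 = ('X^n - 1) ^+ (p ^ t) :> {poly F}.
Proof.
move=> charFp; have ptnat : [pchar {poly F}].-nat (p ^ t)%N.
  have charPp : p \in [pchar {poly F}] by rewrite pchar_poly.
  by rewrite (eq_pnat _ (pcharf_eq charPp)) pnatX pnat_id ?(pcharf_prime charPp).
by rewrite exprDn_pchar // exprNn_pchar // expr1n -exprM mulnC.
Qed.

Lemma dvdp_Xn_sub_1_of_sub_X h n : coprimep h 'X -> h %| 'X^(n.+1) - 'X -> h %| 'X^n - 1.
Proof.
by move=> cohX; rewrite exprSr -[X in _ - X]mul1r -mulrBl Gauss_dvdpl.
Qed.

Lemma coprimep_X f : coprimep f 'X = (f`_0 != 0).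
Proof. by rewrite -['X]subr0 coprimep_XsubC rootE horner_coef0. Qed.

(** The polynomial [f] acts on sequences with ['X] as the shift operator; this is the term of index
    [n] of the result. *)
Definition shift_eval a n f := \sum_(i < size f) f`_i * a (n + i)%N.

Lemma shift_evalE a n f N : (size f <= N)%N ->
  shift_eval a n f = \sum_(i < N) f`_i * a (n + i)%N.
Proof.
move=> szf; rewrite /shift_eval (big_ord_widen N (fun i => f`_i * a (n + i)%N)) //.
rewrite big_mkcond; apply: eq_bigr => i _; case: ltnP => // hi.
by rewrite nth_default // mul0r.
Qed.

Lemma shift_evalD a n f g : shift_eval a n (f + g) = shift_eval a n f + shift_eval a n g.
Proof.
pose N := maxn (size f) (size g).
rewrite !(@shift_evalE _ _ _ N) ?leq_maxl ?leq_maxr ?size_polyD //.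
by rewrite -big_split; apply: eq_bigr => i _; rewrite coefD mulrDl.
Qed.

Lemma shift_evalZ a n c f : shift_eval a n (c *: f) = c * shift_eval a n f.
Proof.
rewrite !(@shift_evalE _ _ _ (size f)) ?size_scale_leq //.
by rewrite mulr_sumr; apply: eq_bigr => i _; rewrite coefZ mulrA.
Qed.

Lemma shift_evalMX a n f : shift_eval a n (f * 'X) = shift_eval a n.+1 f.
Proof.
rewrite (@shift_evalE _ _ _ (size f).+1) ?(leq_trans (size_polyMleq _ _)) ?size_polyX ?addn2 //.
rewrite big_ord_recl coefMX mul0r add0r; apply: eq_bigr => i _.
by rewrite coefMX /= addnS addSn.
Qed.

Lemma shift_eval_Xn a n k : shift_eval a n 'X^k = a (n + k)%N.
Proof.
rewrite /shift_eval size_polyXn (bigD1 ord_max) //= coefXn eqxx mul1r big1 ?addr0 // => i.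
by rewrite coefXn -val_eqE /= => /negPf ->; rewrite mul0r.
Qed.

(** The annihilator of a sequence is an ideal: induct on the cofactor, multiplication by ['X] being
    a shift. *)
Lemma shift_eval_dvdp a f g : f %| g ->
  (forall n, shift_eval a n f = 0) -> forall n, shift_eval a n g = 0.
Proof.
move=> /dvdpP[h ->] Hf; elim/poly_ind: h => [|h c IH] n.
  by rewrite mul0r /shift_eval size_poly0 big_ord0.
by rewrite mulrDl shift_evalD mulrAC shift_evalMX IH mul_polyC shift_evalZ Hf mulr0 addr0.
Qed.

Lemma shift_eval_period a f n : f %| 'X^n - 1 ->
  (forall i, shift_eval a i f = 0) -> forall i, a (i + n)%N = a i.
Proof.
move=> fdv Hf i; apply/eqP; rewrite -subr_eq0; apply/eqP.
rewrite -(shift_eval_dvdp fdv Hf i) shift_evalD -scaleN1r shift_evalZ mulN1r.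
by rewrite shift_eval_Xn -(expr0 'X) shift_eval_Xn addn0.
Qed.

Lemma lrec_shift_eval k a : (0 < k)%N -> satisfies_lrec k a ->
  exists2 f : {poly F}, size f = k.+1 /\ f`_0 != 0 & forall n, shift_eval a n f = 0.
Proof.
move=> k0 [c [c0 Hc]]; pose g := \poly_(i < k) c i.
have szg : (size (- g) < size ('X^k : {poly F}))%N.
  by rewrite size_polyN size_polyXn ltnS size_poly.
exists ('X^k - g) => [|n].
  rewrite size_polyDl // size_polyXn coefB coefXn coef_poly k0.
  (* Since [0 < k], the constant coefficient of the characteristic polynomial is [- c 0]. *)
  by rewrite ltn_eqF // sub0r oppr_eq0.
rewrite shift_evalD shift_eval_Xn -scaleN1r shift_evalZ mulN1r.
rewrite (@shift_evalE _ _ _ k) ?size_poly // Hc; apply/eqP.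
rewrite subr_eq0; apply/eqP; apply: eq_bigr => i _.
by rewrite coef_poly ltn_ord.
Qed.

(** The remainder [n %% m] is again a period and is smaller than [m], so minimality forces it to
    vanish. *)
Lemma least_period_dvdn (T : Type) (b : nat -> T) m n :
  least_period b m -> (forall i, b (i + n)%N = b i) -> (m %| n)%N.
Proof.
move=> [m0 [Hm Hmin]] Hn; rewrite /dvdn; case: posnP => // r0.
suff : (m <= n %% m)%N by rewrite leqNgt ltn_mod m0.
have Hmul j i : b (i + j * m)%N = b i.
  by elim: j => [|j IH] in i *; rewrite ?addn0 // mulSn addnA IH Hm.
apply: Hmin => // i; rewrite -(Hmul (n %/ m)%N) -addnA addnC.
by rewrite [X in (X + _)%N]addnC -divn_eq addnC Hn.
Qed.

(** For nonconstant [f] the index [(size f).-2] is [deg f - 1]: this is the impulse response of [f],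
    with initial values 0, ..., 0, 1. *)
Definition impulse f n := ('X^n %% f)`_(size f).-2.

Lemma coef_mod_eq0 f u : (1 < size f)%N ->
  (forall n, (('X^n * u) %% f)`_(size f).-2 = 0) -> f %| u.
Proof.
move=> szf Hu; apply/modp_eq0P/eqP; apply: contraT => r0.
set r := u %% f in r0.
have f0 : f != 0 by rewrite -size_poly_gt0 ltnW.
have szr : (size r < size f)%N by rewrite ltn_modp.
have sr0 : (0 < size r)%N by rewrite size_poly_gt0.
(* Multiplying the nonzero remainder [r] by this power of ['X] raises its degree to exactly
   [deg f - 1]. No reduction occurs, and the coefficient read off is the leading one of [r]. *)
pose n := ((size f).-1 - size r)%N.
have En : (n + size r = (size f).-1)%N by rewrite subnK // -ltnS prednK // ltnW.
have szn : size ('X^n * r) = (size f).-1 by rewrite mulrC size_mulXn.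
have := Hu n; rewrite -modp_mul modp_small ?szn ?prednK // ?(ltnW szf) //.
move/eqP; rewrite -szn -lead_coefE lead_coef_eq0 mulf_eq0 (negPf r0) orbF.
by rewrite -size_poly_eq0 size_polyXn.
Qed.

(** The multiple [g] of [f] supplies a recurrence of the prescribed degree [k], while the period
    depends on [f] alone: if [n] is a period, then every ['X^i * ('X^n - 1)] has top coefficient 0
    modulo [f], so [coef_mod_eq0] applies. *)
Lemma Pset_of_order f g k m : (1 < size f)%N -> f %| g -> g \is monic ->
  size g = k.+1 -> g`_0 != 0 -> (0 < m)%N ->
  (forall n, (f %| 'X^n - 1) = (m %| n)%N) -> Pset F k m.
Proof.
move=> szf fg gm szg g0 m0 ordf; exists (impulse f); split.
  have k0 : (0 < k)%N.
    have gn0 : g != 0 by rewrite monic_neq0.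
    by rewrite -ltnS -szg (leq_trans szf) // dvdp_leq.
  exists (fun i => - g`_i); rewrite oppr_eq0; split=> // n.
  have Hg : ('X^n * g) %% f = 0 by apply/modp_eq0P; rewrite dvdp_mull.
  have /(congr1 (fun u : {poly F} => u`_(size f).-2)) := Hg.
  rewrite -{1}[g]coefK poly_def szg big_ord_recr /= mulrDr mulr_sumr modpD.
  have -> : g`_k = 1 by have /monicP := gm; rewrite lead_coefE szg.
  rewrite scale1r -exprD coefD coef0 addrC => /eqP; rewrite addr_eq0 => /eqP.
  rewrite -/(impulse f _) => ->.
  have -> : forall (I : finType) (P : I -> {poly F}),
     (\sum_i P i) %% f = \sum_i (P i %% f).
    by move=> I P; apply: (big_morph (fun u => u %% f)) => [x y|]; rewrite ?modpD ?mod0p.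
  rewrite coef_sum -sumrN; apply: eq_bigr => i _.
  by rewrite -scalerAr modpZl coefZ -exprD mulNr.
have per n : (forall i, impulse f (i + n)%N = impulse f i) -> (m %| n)%N.
  move=> Hn; rewrite -ordf; apply: coef_mod_eq0 => // i.
  rewrite mulrBr mulr1 -exprD modpD modpN coefB -[X in X - _]/(impulse f _) Hn.
  by rewrite subrr.
split=> //; split=> [n|n n0 Hn]; last by rewrite dvdn_leq // per.
have : f %| 'X^n * ('X^m - 1) by rewrite dvdp_mull // ordf.
move/modp_eq0P/(congr1 (fun u : {poly F} => u`_(size f).-2)).
rewrite mulrBr mulr1 -exprD modpD modpN coefB coef0.
by move/eqP; rewrite subr_eq0 => /eqP.
Qed.

End Polynomials.

(** * Orders of irreducible polynomials *)

Section FinitePolynomials.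
Variables (F : finFieldType) (p : nat).
Hypothesis charFp : p \in [pchar F].
Local Notation q := #|F|.
Implicit Types (f g h u : {poly F}).

Lemma in_qpoly_eq0 h u : h \is monic -> (1 < size h)%N ->
  (in_qpoly h u == 0) = (h %| u).
Proof.
(* [mk_monic] falls back to ['X] unless its argument is monic and nonconstant. *)
move=> hM szh; have hQ : mk_monic h = h by rewrite /mk_monic szh hM.
by rewrite -val_eqE /= -Pdiv.IdomainMonic.modpE ?hQ.
Qed.

Lemma card_pchar_pow : exists2 e, (0 < e)%N & q = (p ^ e)%N.
Proof.
have := card_pprimeChar charFp; set n := logn _ _ => cardF.
exists n => //; case: n cardF => // /eqP.
by rewrite expn0 gtn_eqF // card_finNzRing_gt1.
Qed.

Lemma pchar_prime : prime p. Proof. exact: pcharf_prime charFp. Qed.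

Lemma pdvd_card d : (0 < d)%N -> (p %| q ^ d)%N.
Proof.
move=> d0; have [e e0 ->] := card_pchar_pow.
by rewrite -expnM dvdn_exp // muln_gt0 e0.
Qed.

Lemma card_exp_gt0 d : (0 < q ^ d)%N.
Proof. by rewrite expn_gt0 (ltnW (card_finNzRing_gt1 F)). Qed.

Lemma coprime_card_sub1 d m : (0 < d)%N -> (m %| q ^ d - 1)%N -> coprime p m.
Proof.
move=> d0 /coprime_dvdr; apply; rewrite prime_coprime ?pchar_prime //.
apply/negP=> pd; have := dvdn_sub (pdvd_card d0) pd.
by rewrite subKn ?card_exp_gt0 // Euclid_dvd1 ?pchar_prime.
Qed.

Lemma natr_coprime_neq0 n : coprime p n -> n%:R != 0 :> F.
Proof. by rewrite -(dvdn_pcharf charFp) -prime_coprime ?pchar_prime. Qed.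

Section Irreducible.
Variable h : {poly F}.
Hypothesis hI : monic_irreducible_poly h.
Let K : finFieldType := {poly %/ h with hI}.

(** The class of ['X] lies in a field with [q ^ deg h] elements, hence is fixed by that power
    map. *)
Lemma irreducible_dvdp_Xcard : h %| 'X^(q ^ (size h).-1) - 'X.
Proof.
rewrite -in_qpoly_eq0 ?hI // -(card_qfpoly hI) raddfB /= rmorphXn subr_eq0.
exact/eqP/(@expf_card K).
Qed.

(* [x ^+ (q ^ d)] is additive on [F[X]/h] and fixes [F] and ['X], hence is the
   identity, so the [q ^ deg h] elements are all roots of ['X^(q ^ d) - 'X]. *)
Lemma irreducible_deg_le d : (0 < d)%N -> h %| 'X^(q ^ d) - 'X -> ((size h).-1 <= d)%N.
Proof.
move=> d0; rewrite -in_qpoly_eq0 ?hI // raddfB /= rmorphXn subr_eq0 => /eqP fixX.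
have fixC (c : F) : c ^+ (q ^ d) = c.
  by elim: d {d0 fixX} => [|d IH]; rewrite ?expn0 ?expr1 // expnS exprM expf_card.
have Qnat : [pchar K].-nat (q ^ d)%N.
  have charK : p \in [pchar {poly %/ h}].
    by apply: (rmorph_pchar (in_qpoly h)); rewrite pchar_poly.
  rewrite (eq_pnat _ (pcharf_eq (charK : p \in [pchar K]))).
  by have [e _ ->] := card_pchar_pow; rewrite -expnM pnatX pnat_id ?pchar_prime.
have fixu u : (in_qpoly h u : K) ^+ (q ^ d) = in_qpoly h u.
  elim/poly_ind: u => [|u c IH].
    by rewrite raddf0 expr0n eqn0Ngt card_exp_gt0.
  rewrite raddfD /= rmorphM /= (@exprDn_pchar K _ _ _ Qnat) (@exprMn K) IH.
  by congr (_ * _ + _); rewrite // -[LHS]rmorphXn /= -polyC_exp fixC.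
have q1 : (1 < q ^ d)%N by rewrite -[X in (X < _)%N](expn0 q) ltn_exp2l ?card_finNzRing_gt1.
have szP : size ('X^(q ^ d) - 'X : {poly K}) = (q ^ d).+1.
  by rewrite size_polyDl ?size_polyXn // size_polyN size_polyX ltnS.
have P0 : 'X^(q ^ d) - 'X != 0 :> {poly K} by rewrite -size_poly_gt0 szP.
have := @max_poly_roots K _ (enum K) P0 _ (enum_uniq K).
rewrite -cardE card_qfpoly szP.
rewrite ltnS leq_exp2l ?card_finNzRing_gt1 //; apply.
apply/allP => x _; rewrite rootE !hornerE subr_eq0.
suff -> : x = in_qpoly h (val x) by rewrite fixu.
by apply/val_inj; rewrite /= Pdiv.Ring.rmodp_small // ?size_mk_monic.
Qed.
End Irreducible.

(** Take the minimal polynomial over [F] of a primitive [m]-th root of unity [z]: it divides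
    ['X^n - 1] iff [z ^+ n = 1]. The degree bound comes from [irreducible_deg_le]. *)
Lemma exists_irreducible_order d m : (0 < d)%N -> (0 < m)%N -> (m %| q ^ d - 1)%N ->
  exists h, [/\ monic_irreducible_poly h, (size h <= d.+1)%N &
    forall n, (h %| 'X^n - 1) = (m %| n)%N].
Proof.
move=> d0 m0 mq.
have mF : m%:R != 0 :> F by apply/natr_coprime_neq0/(coprime_card_sub1 d0 mq).
have P0 : 'X^m - 1 != 0 :> {poly F} by rewrite -polyC1 monic_neq0 ?monicXnsubC.
have [L [rs Hrs _]] := FinSplittingFieldFor P0.
have mL : m%:R != 0 :> L by rewrite -(rmorph_nat (in_alg L)) fmorph_eq0.
rewrite rmorphB /= rmorph1 map_polyXn in Hrs.
(* As [m] is prime to [p], ['X^m - 1] is separable, so it has [m] distinct roots, and one of them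
   must be primitive. *)
have urs : uniq rs.
  by rewrite -separable_prod_XsubC -(eqp_separable Hrs) separable_Xn_sub_1.
have srs : size rs = m.
  have := eqp_size Hrs; rewrite size_prod_XsubC -polyC1 size_XnsubC // => -[].
  by move->.
have ars : all m.-unity_root rs.
  apply/allP=> z zrs; rewrite unity_rootE -subr_eq0.
  have : root ('X^m - 1) z by rewrite (eqp_root Hrs) root_prod_XsubC.
  by rewrite rootE !hornerE.
have /hasP[z _ zprim] : has m.-primitive_root rs.
  by apply: has_prim_root => //; rewrite srs.
(* The minimal polynomial has coefficients in the image of [F] in [L], so it descends to some [h]
   over [F]. *)
have /polyOver1P[h hE] := minPolyOver 1%AS z.
have hdvd u : (h %| u) = root (map_poly (in_alg L) u) z.
  rewrite -(dvdp_map (in_alg L)) -hE; apply/idP/idP.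
    by move/dvdpP=> [v ->]; rewrite rootM root_minPoly orbT.
  by apply: minPoly_dvdp; apply/polyOver1P; exists u.
have hord n : (h %| 'X^n - 1) = (m %| n)%N.
  rewrite hdvd rmorphB /= rmorph1 map_polyXn rootE !hornerE subr_eq0.
  by rewrite (prim_order_dvd zprim).
have hmon : h \is monic by rewrite -(map_monic (in_alg L)) -hE monic_minPoly.
have szh : (1 < size h)%N.
  by rewrite -(size_map_poly (in_alg L)) -hE size_minPoly.
have hI : monic_irreducible_poly h.
  split=> //; split=> // u szu udv.
  have := @minPoly_irr _ L 1%AS z (map_poly (in_alg L) u).
  rewrite hE dvdp_map -[X in _ || (_ %= X)](rmorph1 (map_poly (in_alg L))) !eqp_map.
  case/(_ _ udv)/orP => //; first by apply/polyOver1P; exists u.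
  by rewrite -size_poly_eq1 (negPf szu).
exists h; split=> //; suff : ((size h).-1 <= d)%N by case: (size h).
apply: irreducible_deg_le => //.
have -> : 'X^(q ^ d) - 'X = ('X^(q ^ d - 1) - 1) * 'X :> {poly F}.
  by rewrite mulrBl -exprSr mul1r subn1 prednK // card_exp_gt0.
by rewrite dvdp_mulr // hord.
Qed.

(** Write [n = p ^ s * n1] with [n1] prime to [p]. If [h] divides the separable ['X^n1 - 1] it does
    so exactly once, hence has multiplicity [p ^ s] in ['X^n - 1]; so [h ^+ j] divides iff
    [j <= p ^ s], that is [t <= s]. *)
Lemma order_irreducible_exp h m j t : monic_irreducible_poly h -> coprime p m -> (0 < j)%N ->
  (forall n, (h %| 'X^n - 1) = (m %| n)%N) ->
  (forall s, (j <= p ^ s)%N = (t <= s)%N) ->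
  forall n, (h ^+ j %| 'X^n - 1) = (p ^ t * m %| n)%N.
Proof.
move=> hI pm j0 hord Hj n.
apply/idP/idP => [hn|dn]; last first.
  apply: (dvdp_Xn_sub_1_trans dn); rewrite (Xn_sub_1_pexp _ _ charFp).
  rewrite (@dvdp_trans _ (h ^+ (p ^ t))) ?dvdp_exp2l ?Hj //.
  by rewrite dvdp_exp2r // hord.
case: (posnP n) hn => [-> // | n0].
have [n1 pn1 En] := pfactor_coprime pchar_prime n0.
set s := logn p n in En; rewrite En mulnC => hn.
have [n1_0 hn1] : (0 < n1)%N /\ h %| 'X^n1 - 1.
  split; first by move: n0; rewrite En; case: (n1).
  have : ~~ coprimep h (('X^n1 - 1) ^+ (p ^ s)).
    rewrite (irreducible_poly_coprime _ hI.1) negbK -(Xn_sub_1_pexp _ _ charFp).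
    by rewrite (dvdp_trans _ hn) // -{1}[h]expr1 dvdp_exp2l.
  rewrite coprimep_pexpr ?expn_gt0 ?prime_gt0 ?pchar_prime //.
  by rewrite (irreducible_poly_coprime _ hI.1) negbK.
have mn1 : (m %| p ^ s * n1)%N by rewrite dvdn_mull // -hord.
rewrite Gauss_dvd ?coprimeXl // mn1 andbT dvdn_mulr // dvdn_exp2l // -Hj.
have sepP : separable_poly ('X^n1 - 1 : {poly F}).
  exact/separable_Xn_sub_1/natr_coprime_neq0.
have [g Eg] := dvdpP _ _ hn1.
have cohg : coprimep h g by rewrite (separable_coprime sepP) // Eg mulrC.
rewrite (Xn_sub_1_pexp _ _ charFp) Eg exprMn Gauss_dvdpr in hn; last first.
  by rewrite coprimep_expl // coprimep_expr.
by rewrite dvdp_Pexp2l ?hI in hn.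
Qed.

Lemma Pset_pexp_dvdn d j t k m : (0 < d)%N -> (0 < j)%N -> (d * j <= k)%N ->
  (forall s, (j <= p ^ s)%N = (t <= s)%N) -> D (q ^ d - 1) m -> Pset F k (p ^ t * m).
Proof.
move=> d0 j0 djk Hj [m0 mq].
have pm := coprime_card_sub1 d0 mq.
have [h [hI szh hord]] := exists_irreducible_order d0 m0 mq.
have hM : h \is monic by case: hI.
have szh1 : (1 < size h)%N by case: hI => -[].
have hjM : h ^+ j \is monic by rewrite monic_exp.
have XM : ('X - 1 : {poly F}) \is monic by rewrite -polyC1 monicXsubC.
have szhj : size (h ^+ j) = ((size h).-1 * j).+1.
  by rewrite -[LHS]prednK ?size_poly_gt0 ?monic_neq0 // size_exp.
have lhj : ((size h).-1 * j <= k)%N.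
  by apply: leq_trans djk; rewrite leq_mul2r -subn1 leq_subLR add1n szh orbT.
(* The factor [('X - 1) ^+ r] pads [h ^+ j] to degree [k] and keeps the constant coefficient
   nonzero. *)
pose r := (k - (size h).-1 * j)%N.
have h0 : h`_0 != 0.
  (* If [h] divided ['X], it would divide both ['X^m] and ['X^m - 1], hence 1. *)
  rewrite -coprimep_X (irreducible_poly_coprime _ hI.1); apply/negP => hX.
  have : h %| 'X^m - 1 by rewrite hord.
  rewrite dvdp_addr; last by case: (m) m0 => // m1 _; rewrite exprS dvdp_mulr.
  by rewrite dvdpNr dvdp1 gtn_eqF.
apply: (@Pset_of_order _ (h ^+ j) (h ^+ j * ('X - 1) ^+ r)) => //.
- by rewrite szhj ltnS muln_gt0 j0 andbT; case: (size h) szh1 => // -[].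
- by rewrite dvdp_mulr.
- by rewrite monicMl // monic_exp.
- rewrite size_Mmonic ?monic_neq0 ?monic_exp // szhj -polyC1 size_exp_XsubC.
  by rewrite addSn addnS /= subnKC.
- rewrite -horner_coef0 hornerM !horner_exp !hornerE horner_coef0 mulf_neq0 //.
    by rewrite expf_neq0.
  by rewrite expf_neq0 // oppr_eq0 oner_neq0.
- by rewrite muln_gt0 expn_gt0 prime_gt0 ?pchar_prime.
by apply: order_irreducible_exp.
Qed.

End FinitePolynomials.

(** * Factorisation in degree at most four *)

Section Factorization.
Variables (F : finFieldType).
Local Notation q := #|F|.
Local Notation P d := ('X^(q ^ d - 1) - 1 : {poly F}).
Implicit Types f g h : {poly F}.

Lemma dvdn_exp_sub1 a b n : (a %| b)%N -> (n ^ a - 1 %| n ^ b - 1)%N.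
Proof.
case/dvdnP=> c ->; rewrite mulnC expnM !subn1.
by rewrite [X in (_ %| X)%N]predn_exp dvdn_mulr.
Qed.

Lemma dvdp_Xcard_sub_1_trans a b h : (a %| b)%N -> h %| P a -> h %| P b.
Proof. by move=> ab; apply/dvdp_Xn_sub_1_trans/dvdn_exp_sub1. Qed.

Lemma irreducible_dvdp_Xcard_sub_1 d h : irreducible_poly h -> h`_0 != 0 -> size h = d.+1 -> h %| P d.
Proof.
(* The quotient field needs a monic modulus, so [h] is normalised by its leading coefficient. *)
move=> hI h0 szh; pose c := (lead_coef h)^-1.
have hn0 : h != 0 by rewrite -size_poly_eq0 szh.
have c0 : c != 0 by rewrite invr_eq0 lead_coef_eq0.
have heq : c *: h %= h by apply: eqp_scale.
have hI' : monic_irreducible_poly (c *: h).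
  split; last by rewrite monicE lead_coefZ mulVf ?lead_coef_eq0.
  split; first by rewrite size_scale // hI.
  by move=> g szg; rewrite (eqp_dvdr _ heq) (eqp_rtrans heq); apply: hI.2.
apply: dvdp_Xn_sub_1_of_sub_X; first by rewrite coprimep_X.
rewrite subn1 prednK ?expn_gt0 ?(ltnW (card_finNzRing_gt1 F)) //.
by have := irreducible_dvdp_Xcard hI'; rewrite (eqp_dvdl _ heq) size_scale // szh.
Qed.

(** [irreducibleb] ranges over the finitely many polynomials of smaller size, so its failure yields
    an explicit proper factor. *)
Lemma irreducible_or_factor f : (1 < size f)%N ->
  irreducible_poly f \/ exists g h, [/\ f = g * h, (1 < size g)%N, (1 < size h)%N
    & ((size g).-1 + (size h).-1 = (size f).-1)%N].
Proof.
move=> szf; have [/irreducibleP|] := boolP (irreducibleb f); first by left.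
rewrite /irreducibleb szf /= negb_forall => /existsP[g].
rewrite negb_imply -ltnNge => /andP[gf szg]; right.
have : (size g <= (size f).-1)%N by apply: size_npoly.
move: (g : {poly F}) gf szg => {}g; rewrite -dvdpE => /dvdpP[h Eh] szg szgf.
have fn0 : h * g != 0 by rewrite -Eh -size_poly_gt0 ltnW.
have szE : ((size h).-1 + (size g).-1 = (size f).-1)%N.
  move: fn0; rewrite mulf_eq0 negb_or -!size_poly_gt0 => /andP[sh sg].
  rewrite Eh size_mul -?size_poly_gt0 //.
  by case: (size h) sh => // a _; case: (size g) sg => // b _; rewrite addnS.
exists h, g; split=> //; move: szE szgf szg.
by move: (size h) (size g) (size f) => a b c; lia.
Qed.

Lemma linear_irreducible f : size f = 2 -> irreducible_poly f.
Proof.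
move=> szf; case: (irreducible_or_factor (f := f)) => [|//|[g [h [_]]]]; first by rewrite szf.
by rewrite szf; move: (size h) (size g) => a b; lia.
Qed.

Lemma linear_dvdp_Xcard_sub_1 f : size f = 2 -> f`_0 != 0 -> f %| P 1.
Proof. by move=> szf f0; apply: irreducible_dvdp_Xcard_sub_1 => //; apply: linear_irreducible. Qed.

Lemma irreducible_coprime_size g h : irreducible_poly g -> irreducible_poly h ->
  size g <> size h -> coprimep g h.
Proof.
move=> gI hI szgh; rewrite irreducible_poly_coprime //; apply/negP => gh.
by case: szgh; apply/eqp_size/hI.2 => //; rewrite gtn_eqF // gI.1.
Qed.

Lemma coef0M_neq0 g h : (g * h)`_0 != 0 -> g`_0 != 0 /\ h`_0 != 0.
Proof. by rewrite coef0M mulf_eq0 negb_or => /andP. Qed.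

Lemma quadratic_factor f : size f = 3 ->
  irreducible_poly f \/ exists g h, [/\ f = g * h, size g = 2 & size h = 2].
Proof.
move=> szf; case: (irreducible_or_factor (f := f)); first by rewrite szf.
  by left.
case=> g [h [Ef szg szh]]; rewrite szf => E; right; exists g, h.
by split=> //; move: szg szh E; move: (size h) (size g) => a b; lia.
Qed.

Lemma cubic_factor f : size f = 4 ->
  irreducible_poly f \/ exists g h, [/\ f = g * h, size g = 2 & size h = 3].
Proof.
move=> szf; case: (irreducible_or_factor (f := f)); first by rewrite szf.
  by left.
case=> g [h [Ef szg szh]]; rewrite szf => E; right.
have [|] : (size g = 2 /\ size h = 3) \/ (size h = 2 /\ size g = 3).
- by move: szg szh E; move: (size h) (size g) => a b; lia.
- by case; exists g, h.
by case; exists h, g; rewrite mulrC.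
Qed.

Lemma quartic_factor f : size f = 5 -> irreducible_poly f \/
  exists g h, f = g * h /\ ((size g = 2 /\ size h = 4) \/ (size g = 3 /\ size h = 3)).
Proof.
move=> szf; case: (irreducible_or_factor (f := f)); first by rewrite szf.
  by left.
case=> g [h [Ef szg szh]]; rewrite szf => E; right.
have [|[|]] : (size g = 2 /\ size h = 4) \/ (size h = 2 /\ size g = 4) \/ (size g = 3 /\ size h = 3).
- by move: szg szh E; move: (size h) (size g) => a b; lia.
- by exists g, h; auto.
- by exists h, g; rewrite mulrC; auto.
by exists g, h; auto.
Qed.

Lemma quadratic_dvdp f : size f = 3 -> f`_0 != 0 -> f %| P 2 \/ f %| P 1 ^+ 2.
Proof.
move=> szf f0; case: (quadratic_factor szf) => [fI | [g [h [E szg szh]]]].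
  by left; apply: irreducible_dvdp_Xcard_sub_1.
right; move: f0; rewrite E => /coef0M_neq0[g0 h0].
by rewrite expr2 dvdp_mul // linear_dvdp_Xcard_sub_1.
Qed.

(** Both factors divide [P 2] and they are coprime, so their product costs no power of [P 2]. *)
Lemma linear_quadratic_dvdp g h : size g = 2 -> size h = 3 -> irreducible_poly h ->
  g`_0 != 0 -> h`_0 != 0 -> g * h %| P 2.
Proof.
move=> szg szh hI g0 h0; rewrite Gauss_dvdp.
  by rewrite (dvdp_Xcard_sub_1_trans _ (linear_dvdp_Xcard_sub_1 szg g0)) ?(irreducible_dvdp_Xcard_sub_1 hI).
by apply: irreducible_coprime_size; rewrite ?szg ?szh //; apply: linear_irreducible.
Qed.

Lemma cubic_dvdp f : size f = 4 -> f`_0 != 0 -> [\/ f %| P 3, f %| P 2 | f %| P 1 ^+ 3].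
Proof.
move=> szf f0; case: (cubic_factor szf) => [fI | [g [h [E szg szh]]]].
  by constructor 1; apply: irreducible_dvdp_Xcard_sub_1.
move: f0; rewrite E => /coef0M_neq0[g0 h0].
case: (quadratic_factor szh) => [hI | [h1 [h2 [Eh sz1 sz2]]]].
  by constructor 2; apply: linear_quadratic_dvdp.
move: h0; rewrite Eh => /coef0M_neq0[h10 h20].
by constructor 3; rewrite !exprS expr0 mulr1 !dvdp_mul // linear_dvdp_Xcard_sub_1.
Qed.

Lemma quadratic_quadratic_dvdp g h : size g = 3 -> size h = 3 -> g`_0 != 0 -> h`_0 != 0 ->
  g * h %| P 2 ^+ 2 \/ g * h %| P 1 ^+ 4.
Proof.
move=> szg szh g0 h0.
(* With [u] irreducible and [v = v1 * v2] split, regroup as [(u * v1) * v2]: each of the two groups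
   divides [P 2]. *)
have half (u v : {poly F}) : size u = 3 -> irreducible_poly u -> u`_0 != 0 -> v`_0 != 0 ->
    (exists v1 v2, [/\ v = v1 * v2, size v1 = 2 & size v2 = 2]) -> u * v %| P 2 ^+ 2.
  move=> szu uI u0 v0 [v1 [v2 [Ev sz1 sz2]]].
  move: v0; rewrite Ev => /coef0M_neq0[v10 v20].
  rewrite mulrA [u * v1]mulrC expr2 dvdp_mul ?linear_quadratic_dvdp //.
  by rewrite (dvdp_Xcard_sub_1_trans (a := 1)) // linear_dvdp_Xcard_sub_1.
have [gI|gS] := quadratic_factor szg; have [hI|hS] := quadratic_factor szh.
- by left; rewrite expr2 dvdp_mul // irreducible_dvdp_Xcard_sub_1.
- by left; apply: half.
- by left; rewrite mulrC; apply: half.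
case: gS hS => [g1 [g2 [Eg sg1 sg2]]] [h1 [h2 [Eh sh1 sh2]]]; right.
move: g0 h0; rewrite Eg Eh => /coef0M_neq0[g10 g20] /coef0M_neq0[h10 h20].
by rewrite (exprD _ 2 2) !expr2 !dvdp_mul // linear_dvdp_Xcard_sub_1.
Qed.

(** A linear factor and an irreducible cubic are coprime divisors of [P 3]. Every other reducible
    quartic is a product of two quadratics. *)
Lemma quartic_dvdp f : size f = 5 -> f`_0 != 0 ->
  [\/ f %| P 4, f %| P 3, f %| P 2 ^+ 2 | f %| P 1 ^+ 4].
Proof.
move=> szf f0; case: (quartic_factor szf) => [fI | [g [h [E sz]]]].
  by constructor 1; apply: irreducible_dvdp_Xcard_sub_1.
move: f0; rewrite E => /coef0M_neq0[g0 h0].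
case: sz => -[szg szh]; last first.
  by have [] := quadratic_quadratic_dvdp szg szh g0 h0; [constructor 3 | constructor 4].
case: (cubic_factor szh) => [hI | [h1 [h2 [Eh sz1 sz2]]]].
  constructor 2; rewrite Gauss_dvdp.
    by rewrite (dvdp_Xcard_sub_1_trans _ (linear_dvdp_Xcard_sub_1 szg g0)) ?(irreducible_dvdp_Xcard_sub_1 hI).
  by apply: irreducible_coprime_size; rewrite ?szg ?szh //; apply: linear_irreducible.
move: h0; rewrite Eh => /coef0M_neq0[h10 h20].
have szgh1 : size (g * h1) = 3.
  by rewrite size_mul ?szg ?sz1 // -size_poly_eq0 ?szg ?sz1.
have gh10 : (g * h1)`_0 != 0 by rewrite coef0M mulf_neq0.
by rewrite mulrA; have [] := quadratic_quadratic_dvdp szgh1 sz2 gh10 h20; [constructor 3 | constructor 4].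
Qed.

End Factorization.

(** * Powers of the characteristic in the period, and the four degrees *)

Lemma dvdn_pexp_mul p t n m : prime p -> (m %| p ^ t * n)%N -> (0 < n)%N ->
  exists i x, [/\ (i <= t)%N, D n x & m = (p ^ i * x)%N].
Proof.
move=> pp mdv n0; have g0 : (0 < gcdn m (p ^ t))%N by rewrite gcdn_gt0 expn_gt0 (prime_gt0 pp) orbT.
(* The exponent [i] is read off [gcdn m (p ^ t)]; the cofactor of [m] is coprime to what remains of
   [p ^ t], so it divides [n]. *)
have /(dvdn_pfactor _ _ pp)[i it Ei] : (gcdn m (p ^ t) %| p ^ t)%N by apply: dvdn_gcdr.
exists i, (m %/ p ^ i)%N; rewrite -Ei; split=> //; last by rewrite mulnC divnK ?dvdn_gcdl.
have mdv' : (m %/ gcdn m (p ^ t) %| n)%N.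
  rewrite -(@Gauss_dvdr _ (p ^ t %/ gcdn m (p ^ t))); last first.
    by rewrite /coprime -(eqn_pmul2r g0) muln_gcdl !divnK ?dvdn_gcdl ?dvdn_gcdr ?mul1n.
  by rewrite -(dvdn_pmul2r g0) divnK ?dvdn_gcdl // mulnAC divnK ?dvdn_gcdr.
by split=> //; apply: dvdn_gt0 mdv'.
Qed.

Lemma leq_pexp_threshold p j t : (1 < p)%N -> (p ^ t < j)%N -> (j <= p ^ t.+1)%N ->
  forall s, (j <= p ^ s)%N = (t.+1 <= s)%N.
Proof.
move=> p1 lj jl s; apply/idP/idP => [js | ts].
  by rewrite -(ltn_exp2l _ _ p1) (leq_trans lj).
by rewrite (leq_trans jl) // leq_exp2l.
Qed.

(** Since [n <= p ^ t], [f] divides ['X^(p ^ t * (q ^ d - 1)) - 1], whose exponent is thus a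
    multiple of the least period. *)
Lemma period_of_dvdp (F : finFieldType) p (a : nat -> F) f m d n t : p \in [pchar F] ->
  (forall i, shift_eval a i f = 0) -> least_period a m -> (0 < d)%N ->
  f %| ('X^(#|F| ^ d - 1) - 1) ^+ n -> (n <= p ^ t)%N ->
  exists i x, [/\ (i <= t)%N, D (#|F| ^ d - 1) x & m = (p ^ i * x)%N].
Proof.
move=> cp fa am d0 fd nt.
apply: dvdn_pexp_mul; first exact: pcharf_prime cp; last first.
  by rewrite subn_gt0 -[X in (X < _)%N](expn0 #|F|) ltn_exp2l ?card_finNzRing_gt1.
apply: (least_period_dvdn am); apply: (@shift_eval_period _ _ f) => //.
by rewrite (Xn_sub_1_pexp _ _ cp) (dvdp_trans fd) ?dvdp_exp2l.
Qed.

Theorem theorem3p5 (F : finFieldType) (p : nat) (hp : (p \in [pchar F])%R) :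
  let q := #|F| in
  (forall m, Pset F 1 m <-> D (q - 1) m) /\
  (forall m, Pset F 2 m <-> D (q ^ 2 - 1) m \/ smul p (D (q - 1)) m) /\
  (forall m, Pset F 3 m <->
     if (3 <= p)%N then
       D (q ^ 3 - 1) m \/ D (q ^ 2 - 1) m \/ smul p (D (q - 1)) m
     else
       D (q ^ 3 - 1) m \/ D (q ^ 2 - 1) m \/
       setmul (fun x => x = 2%N \/ x = 4%N) (D (q - 1)) m) /\
  (forall m, Pset F 4 m <->
     if (5 <= p)%N then
       D (q ^ 4 - 1) m \/ D (q ^ 3 - 1) m \/ smul p (D (q ^ 2 - 1)) m
     else
       D (q ^ 4 - 1) m \/ D (q ^ 3 - 1) m \/ smul p (D (q ^ 2 - 1)) m \/
       smul (p ^ 2) (D (q - 1)) m).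
Proof.
move=> q.
have pp := pcharf_prime hp; have p1 := prime_gt1 pp; have p0 := ltnW p1.
have D1 : D (q - 1) = D (q ^ 1 - 1) by rewrite expn1.
have Dtrans a b m : (a %| b)%N -> D (q ^ a - 1) m -> D (q ^ b - 1) m.
  by move=> ab [m0 mq]; split=> //; apply: dvdn_trans mq (dvdn_exp_sub1 _ ab).
(* The least [t] with [j <= p ^ t] is 0 for [j = 1] and 1 for [j = 2], whatever the prime [p]. *)
have th1 s : (1 <= p ^ s)%N = (0 <= s)%N by rewrite expn_gt0 p0.
have th2 := leq_pexp_threshold (t := 0) p1 (isT : 1 < 2)%N p1.
have low0 d k m : (0 < d <= k)%N -> D (q ^ d - 1) m -> Pset F k m.
  case/andP=> d0 dk Dm; rewrite -[m]mul1n -(expn0 p).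
  by apply: (Pset_pexp_dvdn hp d0 _ _ th1 Dm); rewrite ?muln1.
have low1 d k m : (0 < d)%N -> (d * 2 <= k)%N -> smul p (D (q ^ d - 1)) m -> Pset F k m.
  move=> d0 dk [x [Dx ->]]; rewrite -{1}(expn1 p).
  exact: (Pset_pexp_dvdn hp d0 _ dk th2 Dx).
(* Here the [j]-th power of a linear polynomial is used; [p < j <= p ^ 2] makes the exponent exactly
   2. *)
have low2 k j m : (0 < j <= k)%N -> (p < j <= p ^ 2)%N -> smul (p ^ 2) (D (q ^ 1 - 1)) m ->
    Pset F k m.
  move=> /andP[j0 jk] /andP[pj jp] [x [Dx ->]].
  apply: (@Pset_pexp_dvdn _ _ hp 1 j 2) => //; first by rewrite mul1n.
  exact: (leq_pexp_threshold (t := 1)).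
(* [up0], [up1] and [up2] list the possible powers of [p] in the period when the multiplicity is at
   most 1, [p] and [p ^ 2]. *)
have up0 (a : nat -> F) f d m : (forall i, shift_eval a i f = 0) -> least_period a m -> (0 < d)%N ->
    f %| 'X^(q ^ d - 1) - 1 -> D (q ^ d - 1) m.
  move=> fa am d0 fd; have := @period_of_dvdp F p a f m d 1 0 hp fa am d0 fd (th1 0).
  by case=> i [x []]; rewrite leqn0 => /eqP-> Dx ->; rewrite mul1n.
have up1 (a : nat -> F) f d n m : (forall i, shift_eval a i f = 0) -> least_period a m -> (0 < d)%N ->
    f %| ('X^(q ^ d - 1) - 1) ^+ n -> (n <= p)%N ->
    D (q ^ d - 1) m \/ smul p (D (q ^ d - 1)) m.
  move=> fa am d0 fd np; have := @period_of_dvdp F p a f m d n 1 hp fa am d0 fd np.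
  case=> i [x [it Dx ->]]; case: i it => [|[|//]] _; first by left; rewrite mul1n.
  by right; exists x; rewrite expn1.
have up2 (a : nat -> F) f d n m : (forall i, shift_eval a i f = 0) -> least_period a m -> (0 < d)%N ->
    f %| ('X^(q ^ d - 1) - 1) ^+ n -> (n <= p ^ 2)%N ->
    [\/ D (q ^ d - 1) m, smul p (D (q ^ d - 1)) m | smul (p ^ 2) (D (q ^ d - 1)) m].
  move=> fa am d0 fd np; have := @period_of_dvdp F p a f m d n 2 hp fa am d0 fd np.
  case=> i [x [it Dx ->]]; case: i it => [|[|[|//]]] _; first by constructor 1; rewrite mul1n.
    by constructor 2; exists x; rewrite expn1.
  by constructor 3; exists x.
(* These inclusions absorb periods prime to [p] that come from repeated factors of lower degree. *)
have D12 m : D (q ^ 1 - 1) m -> D (q ^ 2 - 1) m by apply: Dtrans.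
have D14 m : D (q ^ 1 - 1) m -> D (q ^ 4 - 1) m by apply: Dtrans.
have D24 m : D (q ^ 2 - 1) m -> D (q ^ 4 - 1) m by apply: Dtrans.
rewrite D1; split=> [m|].
  split=> [[a [/lrec_shift_eval[//|f [szf f0] fa] am]]|]; last exact: low0.
  by apply: up0 fa am _ _ => //; apply: linear_dvdp_Xcard_sub_1.
split=> [m|].
  split=> [[a [/lrec_shift_eval[//|f [szf f0] fa] am]]|[]]; [|exact: low0|exact: low1].
  have [fd|fd] := quadratic_dvdp szf f0; first by left; apply: up0 fa am _ fd.
  by have [/D12|] := up1 _ _ 1%N _ _ fa am isT fd p1; auto.
split=> m.
  have sub : Pset F 3 m -> [\/ D (q ^ 3 - 1) m, D (q ^ 2 - 1) m |
      exists (a : nat -> F) f, [/\ forall i, shift_eval a i f = 0, least_period a m & f %| ('X^(q ^ 1 - 1) - 1) ^+ 3]].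
    case=> a [/lrec_shift_eval[//|f [szf f0] fa] am].
    have [fd|fd|fd] := cubic_dvdp szf f0.
    - by constructor 1; apply: up0 fa am _ fd.
    - by constructor 2; apply: up0 fa am _ fd.
    by constructor 3; exists a, f.
  case: ltnP => p3; split.
  - case/sub => [||[a [f [fa am fd]]]]; auto.
    by have [/D12|] := up1 _ _ 1%N _ _ fa am isT fd p3; auto.
  - by case=> [|[]]; [exact: low0|exact: low0|exact: low1].
  - have p2 : p = 2 by apply/eqP; rewrite eqn_leq p1 p3.
    case/sub => [||[a [f [fa am fd]]]]; auto.
    have [||[x [Dx Ex]]|[x [Dx Ex]]] := up2 _ _ 1%N _ _ fa am isT fd; first by rewrite p2.
    + by move/D12; auto.
    + by right; right; exists 2, x; rewrite Ex p2; auto.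
    by right; right; exists 4, x; rewrite Ex p2; auto.
  - have p2 : p = 2 by apply/eqP; rewrite eqn_leq p1 p3.
    case=> [|[|[x [y [Ex [Dy Em]]]]]]; [exact: low0|exact: low0|].
    case: Ex Em => -> ->.
      by apply: (low1 1) => //; exists y; rewrite p2.
    (* The cube of a linear polynomial: [2 < 3 <= 4], giving the factor 4. *)
    by apply: (low2 3 3) => //; rewrite p2 //; exists y.
have sub : Pset F 4 m -> [\/ D (q ^ 4 - 1) m, D (q ^ 3 - 1) m, smul p (D (q ^ 2 - 1)) m |
    exists (a : nat -> F) f, [/\ forall i, shift_eval a i f = 0, least_period a m & f %| ('X^(q ^ 1 - 1) - 1) ^+ 4]].
  case=> a [/lrec_shift_eval[//|f [szf f0] fa] am].
  have [fd|fd|fd|fd] := quartic_dvdp szf f0.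
  - by constructor 1; apply: up0 fa am _ fd.
  - by constructor 2; apply: up0 fa am _ fd.
  - have [/D24 H|H] := up1 _ _ 2%N _ _ fa am isT fd p1; last by constructor 3.
    by constructor 1.
  by constructor 4; exists a, f.
(* This is why [p D(q - 1)] does not appear separately in degree 4. *)
have up_smul : smul p (D (q ^ 1 - 1)) m -> smul p (D (q ^ 2 - 1)) m.
  by case=> x [Dx ->]; exists x; split=> //; apply: Dtrans Dx.
case: ltnP => p5; split.
- case/sub => [|||[a [f [fa am fd]]]]; auto.
  by have [/D14|/up_smul] := up1 _ _ 1%N _ _ fa am isT fd (ltnW p5); auto.
- by case=> [|[]]; [exact: low0|exact: low0|exact: low1].
- have p4 : (4 <= p ^ 2)%N by rewrite (@leq_exp2r 2 p 2).
  case/sub => [|||[a [f [fa am fd]]]]; auto.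
  have [/D14|/up_smul|] := up2 _ _ 1%N _ _ fa am isT fd p4; auto.
(* From [p < 5] and 4 not being prime, [p] is 2 or 3, so the fourth power of a linear polynomial
   produces [p ^ 2]. *)
have p4 : (p < 4 <= p ^ 2)%N.
  rewrite (@leq_exp2r 2 p 2) // p1 andbT ltn_neqAle p5 andbT.
  by apply: contraTneq pp => ->.
case=> [|[|[]]]; [exact: low0|exact: low0|exact: low1|exact: (low2 4 4)].
Qed.
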